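(* For every integer $n\geq 0$, we have \begin{align*} ped(225n+43) &\equiv 0 \pmod{24},\\ ped(225n+88) &\equiv 0 \pmod{24},\\ ped(225n+133) &\equiv 0 \pmod{24},\\ ped(225n+223) &\equiv 0 \pmod{24}. \end{align*} Furthermore, for all integers $k\geq 1$ and $n\geq 0$, we have $$ped(9n+7)\equiv ped\left(9\cdot 5^{2k}n+\frac{57\cdot 5^{2k}-1}{8}\right)\pmod{24}.$$
   Context: For an integer $n\geq 0$, $ped(n)$ denotes the number of partitions of $n$ in which the even parts are distinct and the odd parts are unrestricted (i.e. no even part is repeated, while odd parts may be repeated arbitrarily), with $ped(0)=1$. Equivalently, $ped(n)$ is given by the generating function $$\sum_{n=0}^{\infty} ped(n)q^n=\frac{(-q^2;q^2)_{\infty}}{(q;q^2)_{\infty}}=\frac{(q^4;q^4)_{\infty}}{(q;q)_{\infty}},$$ where $(a;q)_{\infty}=\prod_{n=0}^{\infty}(1-aq^n)$ for $|q|<1$. Note that $57\cdot 5^{2k}-1$ is divisible by $8$ for every $k\geq 1$, so the argument of $ped$ on the right-hand side is a nonnegative integer. *)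

(* Defs.v *)
From mathcomp Require Import all_boot.

Set Implicit Arguments.
Unset Strict Implicit.
Unset Printing Implicit Defensive.

(* A partition of n, as a multiset of positive integers, is given by its       *)
(* multiplicities: m i is the number of parts equal to i.+1. Parts and         *)
(* multiplicities of a partition of n are both at most n, whence the bounds.   *)
Definition is_partition (n : nat) (m : {ffun 'I_n -> 'I_n.+1}) : bool :=
  \sum_(i < n) m i * i.+1 == n.

Definition even_parts_distinct (n : nat) (m : {ffun 'I_n -> 'I_n.+1}) : bool :=
  [forall i : 'I_n, ~~ odd i.+1 ==> (m i <= 1)].

Definition ped (n : nat) : nat :=
  #|[set m : {ffun 'I_n -> 'I_n.+1} | is_partition m && even_parts_distinct m]|.

(* Main.v *)
Require Import Defs.
From HB Require Import structures.
From mathcomp Require Import all_boot all_order all_algebra.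
From mathcomp Require Import boolp zify ring.

(** Put phi(q) = sum of q^(k^2) over k in Z, psi(q) = sum of q^(k(k+1)/2) over
k >= 0, and P(q) = sum of (-1)^n ped(n) q^n. Everything follows from
<<
  P phi = psi                                        [ped_phi]
>>
which combines two facts. First, P(q) is the product of
(1 + q^(2i)) / (1 + q^(2i-1)), and Gauss's product for psi [gauss] turns this
into P(q) psi(q) = psi(q^2) [ped_psi]. Second, psi(q)^2 = psi(q^2) phi(q)
[psi_sqr], a consequence of r_2(2n) = r_2(n) for the number r_2 of
representations as a sum of two squares and of the splitting of phi into even
and odd exponents.

All the arguments N of ped in the theorem are 7 modulo 9, and there ped(N) is
found modulo 3 and modulo 8.

Modulo 3, the same two-square identities give phi^4 = 1 - q psi(q^2)^4
[phi_pow4_char3]. Since cubing is the substitution q -> q^3, this yields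
<<
  P phi(q^9)^2 = phi(q^9) psi - q psi(q^9) phi
                 + q^2 psi(q^9) psi(q^6) psi^2 - q psi(q^9) phi(q^9),
>>
and no term on the right has an exponent congruent to 7 modulo 9: triangular
numbers are 0, 1, 3, 6 and squares are 0, 1, 4, 7 modulo 9. Hence 3 divides
ped(N) [ped_mod3].

Modulo 8, expanding 1/phi, where phi is 1 modulo 2, and discarding exponents
in the same way leaves P = - psi phi in the class of 7 [ped_mod8]. The
coefficient c(N) of psi phi counts the solutions of x^2 + 8 y^2 = 8N + 1 with
x > 0 odd and y in Z. It is divisible by 4 [reps_dvd4], which makes the sign
(-1)^N harmless, so that ped(N) = c(N) modulo 8 [ped_reps]. As -8 is not a
square modulo 5, a solution with 5 | 8N + 1 has both x and y divisible by 5.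
So c(N) = 0 when 5 divides 8N + 1 exactly once [reps_empty], and c is unchanged
when 8N + 1 is multiplied by 25 [reps_scale]. The first four congruences are
instances of the former, the last one of the latter. *)

Set Implicit Arguments.
Unset Strict Implicit.
Unset Printing Implicit Defensive.
Import GRing.Theory.
Local Open Scope ring_scope.

(** * Formal power series *)

(** A wrapper around [nat -> R], so that the convolution product does not compete
with the pointwise operations on functions. *)
Record fps (R : Type) := Fps { fcoef :> nat -> R }.
HB.instance Definition _ (R : Type) := gen_eqMixin (fps R).
HB.instance Definition _ (R : Type) := gen_choiceMixin (fps R).

Lemma fpsP (R : Type) (f g : fps R) : f =1 g -> f = g.
Proof. by case: f g => [f] [g] /= /funext ->. Qed.

Section FpsRing.
Variable R : comNzRingType.
Implicit Types f g h : fps R.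

Definition trunc n f : {poly R} := \poly_(i < n) f i.

Lemma coef_trunc n f i : (i < n)%N -> (trunc n f)`_i = f i.
Proof. by move=> lt_in; rewrite coef_poly lt_in. Qed.

Definition fps_add f g := Fps (fun n => f n + g n).
Definition fps_opp f := Fps (fun n => - f n).
Definition fps_zero : fps R := Fps (fun=> 0).
Definition fps_one : fps R := Fps (fun n => (n == 0%N)%:R).
Definition fps_mul f g := Fps (fun n => \sum_(i < n.+1) f i * g (n - i)%N).

Lemma fps_addA : associative fps_add.
Proof. by move=> f g h; apply: fpsP => n /=; rewrite addrA. Qed.
Lemma fps_addC : commutative fps_add.
Proof. by move=> f g; apply: fpsP => n /=; rewrite addrC. Qed.
Lemma fps_add0 : left_id fps_zero fps_add.
Proof. by move=> f; apply: fpsP => n /=; rewrite add0r. Qed.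
Lemma fps_addN : left_inverse fps_zero fps_opp fps_add.
Proof. by move=> f; apply: fpsP => n /=; rewrite addNr. Qed.

HB.instance Definition _ :=
  GRing.isZmodule.Build (fps R) fps_addA fps_addC fps_add0 fps_addN.

(** A coefficient of a product only involves lower coefficients, so it can be
computed on polynomial truncations; the ring axioms are inherited this way. *)
Lemma fps_mul_poly N n f g (p r : {poly R}) : (n < N)%N ->
  (forall i, (i < N)%N -> f i = p`_i) -> (forall i, (i < N)%N -> g i = r`_i) ->
  fps_mul f g n = (p * r)`_n.
Proof.
move=> ltnN fp gr; rewrite coefM; apply: eq_bigr => i _.
by rewrite fp ?gr //; have := ltn_ord i; lia.
Qed.

Lemma fps_mulC : commutative fps_mul.
Proof.
move=> f g; apply: fpsP => n; pose T := trunc n.+1.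
have E (h : fps R) i : (i < n.+1)%N -> h i = (T h)`_i by move=> ?; rewrite coef_trunc.
by rewrite !(fps_mul_poly (ltnSn n) (E _) (E _)) mulrC.
Qed.

Lemma fps_mulA : associative fps_mul.
Proof.
move=> f g h; apply: fpsP => n; pose T := trunc n.+1.
have E (k : fps R) i : (i < n.+1)%N -> k i = (T k)`_i by move=> ?; rewrite coef_trunc.
have EM k l i : (i < n.+1)%N -> fps_mul k l i = (T k * T l)`_i.
  by move=> lti; rewrite (fps_mul_poly lti (E _) (E _)).
by rewrite (fps_mul_poly (ltnSn n) (E _) (EM _ _)) mulrA
           (fps_mul_poly (ltnSn n) (EM _ _) (E _)).
Qed.

Lemma fps_mul1 : left_id fps_one fps_mul.
Proof.
move=> f; apply: fpsP => n /=.
by rewrite big_ord_recl /= mul1r subn0 big1 ?addr0 // => i _; rewrite mul0r.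
Qed.

Lemma fps_mulDl : left_distributive fps_mul fps_add.
Proof.
move=> f g h; apply: fpsP => n /=; rewrite -big_split /=.
by apply: eq_bigr => i _; rewrite mulrDl.
Qed.

Lemma fps_one_neq0 : fps_one != 0.
Proof. by apply/eqP => /(congr1 (fun f => fcoef f 0)) /= /eqP; rewrite oner_eq0. Qed.

HB.instance Definition _ := GRing.Zmodule_isComNzRing.Build (fps R)
  fps_mulA fps_mulC fps_mul1 fps_mulDl fps_one_neq0.

Lemma fps_coef1 n : (1 : fps R) n = (n == 0%N)%:R. Proof. by []. Qed.
Lemma fps_coefD f g n : (f + g) n = f n + g n. Proof. by []. Qed.
Lemma fps_coefN f n : (- f) n = - f n. Proof. by []. Qed.
Lemma fps_coefM f g n : (f * g) n = \sum_(i < n.+1) f i * g (n - i)%N.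
Proof. by []. Qed.
Lemma fps_coefMn f k n : (f *+ k) n = f n *+ k.
Proof. by elim: k => //= k IH; rewrite !mulrS fps_coefD IH. Qed.
Lemma fps_coef_sum (I : Type) (s : seq I) (P : pred I) (F : I -> fps R) n :
  (\sum_(i <- s | P i) F i) n = \sum_(i <- s | P i) F i n.
Proof. by elim/big_rec2: _ => // i y1 y2 _ <-. Qed.

Definition fX : fps R := Fps (fun n => (n == 1%N)%:R).

Lemma fps_coefXn k n : (fX ^+ k) n = (n == k)%:R.
Proof.
elim: k n => // k IH n; rewrite exprS fps_coefM.
case: n => [|n]; first by rewrite big_ord1 mul0r.
rewrite 2!big_ord_recl big1 => [|i _]; last by rewrite mul0r.
by rewrite /= mul0r add0r mul1r addr0 subSS subn0 IH.
Qed.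

Lemma fps_coefXnM k f n :
  (fX ^+ k * f) n = if (k <= n)%N then f (n - k)%N else 0.
Proof.
rewrite fps_coefM; case: leqP => [lekn|ltnk].
  have lt : (k < n.+1)%N by [].
  rewrite (bigD1 (Ordinal lt)) //= fps_coefXn eqxx mul1r big1 ?addr0 // => i ne.
  rewrite fps_coefXn; case: eqP => [e|_]; last by rewrite mul0r.
  by case/eqP: ne; apply: val_inj.
rewrite big1 // => i _; rewrite fps_coefXn; case: eqP => [e|_]; last by rewrite mul0r.
by have := ltn_ord i; lia.
Qed.

Lemma fps_coefXM f n : (fX * f) n.+1 = f n.
Proof. by rewrite -[fX]expr1 fps_coefXnM subSS subn0. Qed.

Lemma fXI f g : fX * f = fX * g -> f = g.
Proof. by move=> e; apply: fpsP => n; rewrite -(fps_coefXM f) e fps_coefXM. Qed.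

End FpsRing.
Arguments fX {R}.

(** * Congruence modulo powers of q *)

Section Truncation.
Variable R : comNzRingType.
Implicit Types f g h : fps R.

Definition eqm N f g := forall n, (n < N)%N -> f n = g n.

Lemma eqm_refl N f : eqm N f f. Proof. by []. Qed.
Lemma eqm_sym N f g : eqm N f g -> eqm N g f.
Proof. by move=> fg n ltnN; rewrite fg. Qed.
Lemma eqm_trans N g f h : eqm N f g -> eqm N g h -> eqm N f h.
Proof. by move=> fg gh n ltnN; rewrite fg // gh. Qed.
Lemma eqm_le M N f g : (M <= N)%N -> eqm N f g -> eqm M f g.
Proof. by move=> le fg n ltn; apply/fg/(leq_trans ltn). Qed.

Lemma eqm_mul N f1 f2 g1 g2 : eqm N f1 g1 -> eqm N f2 g2 -> eqm N (f1 * f2) (g1 * g2).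
Proof.
move=> e1 e2 n ltnN; rewrite !fps_coefM; apply: eq_bigr => i _.
by rewrite e1 ?e2 //; have := ltn_ord i; lia.
Qed.

Lemma eqm_prod N (I : Type) (s : seq I) (P : pred I) (F G : I -> fps R) :
  (forall i, P i -> eqm N (F i) (G i)) ->
  eqm N (\prod_(i <- s | P i) F i) (\prod_(i <- s | P i) G i).
Proof.
by move=> FG; elim/big_rec2: _ => // i x y Pi xy; apply: eqm_mul => //; exact: FG.
Qed.

Lemma eqm_Xn N k f : (N <= k)%N -> eqm N (fX ^+ k * f) 0.
Proof. by move=> leNk n ltnN; rewrite fps_coefXnM leqNgt (leq_trans ltnN leNk). Qed.

(** A series with constant term 1 is invertible; cancelling it instead of
inverting it keeps every identity free of division. *)
Lemma eqm_mulI N f g h : f 0%N = 1 -> eqm N (f * g) (f * h) -> eqm N g h.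
Proof.
move=> f0 e n; elim/ltn_ind: n => n IH ltnN.
have := e n ltnN; rewrite !fps_coefM !big_ord_recl /= f0 !mul1r subn0.
rewrite (eq_bigr (fun i : 'I_n => f (bump 0 i) * h (n - bump 0 i)%N)).
  by move/addIr.
by move=> i _; rewrite IH //; rewrite /bump; have := ltn_ord i; lia.
Qed.

Lemma eqm_all f g : (forall N, eqm N f g) -> f = g.
Proof. by move=> fg; apply: fpsP => n; apply: (fg n.+1). Qed.

Lemma coef0_mulI f g h : f 0%N = 1 -> f * g = f * h -> g = h.
Proof. by move=> f0 e; apply: eqm_all => N; apply: (eqm_mulI f0); rewrite e. Qed.

Lemma fps_mul_coef0 f g : (f * g) 0%N = f 0%N * g 0%N.
Proof. by rewrite fps_coefM big_ord1. Qed.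

End Truncation.

(** * The substitution of q^d for q, and Frobenius *)

Section Dilation.
Variable R : comNzRingType.
Implicit Types f g h : fps R.

Definition dil d f := Fps (fun n => if (d %| n)%N then f (n %/ d)%N else 0).

Lemma coef_dil d f n : dil d f n = if (d %| n)%N then f (n %/ d)%N else 0.
Proof. by []. Qed.

Lemma dil_poly d f N n : (0 < d)%N -> (n < N)%N ->
  dil d f n = (trunc N f \Po 'X^d)`_n.
Proof.
move=> d_gt0 ltnN; rewrite coef_comp_poly_Xn //=; case: ifP => // _.
by rewrite coef_trunc // (leq_ltn_trans (leq_div _ _)).
Qed.

Lemma dilM d : {morph dil d.+1 : f g / f * g}.
Proof.
move=> f g; apply: fpsP => n.
have dilE (h : fps R) i : (i < n.+1)%N -> dil d.+1 h i = (trunc n.+1 h \Po 'X^(d.+1))`_i.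
  exact: dil_poly.
rewrite [RHS](fps_mul_poly (ltnSn n) (dilE f) (dilE g)).
rewrite -rmorphM /= coef_comp_poly_Xn //=; case: ifP => // _.
apply: (@fps_mul_poly _ n.+1); first by rewrite ltnS leq_div.
- by move=> i lti; rewrite coef_trunc.
- by move=> i lti; rewrite coef_trunc.
Qed.

Lemma dil_zmod d : zmod_morphism (dil d.+1).
Proof.
by move=> f g; apply: fpsP => n /=; case: ifP => //= _; rewrite subr0.
Qed.

Lemma dil_monoid d : monoid_morphism (dil d.+1).
Proof.
split; last exact: dilM.
apply: fpsP => n /=; case: ifP => [dvd|]; last by case: n.
by congr ((nat_of_bool _)%:R); case/dvdnP: dvd => k ->; rewrite mulnK // muln_eq0 orbF.
Qed.

(* The successor in the index keeps out d = 0, for which the substitution is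
   not defined on series. *)
HB.instance Definition _ d :=
  GRing.isZmodMorphism.Build (fps R) (fps R) (dil d.+1) (@dil_zmod d).
HB.instance Definition _ d :=
  GRing.isMonoidMorphism.Build (fps R) (fps R) (dil d.+1) (@dil_monoid d).

Lemma dil_dil d e f : (0 < d)%N -> dil d (dil e f) = dil (d * e) f.
Proof.
move=> d_gt0; apply: fpsP => n /=.
case: (boolP (d %| n)%N) => [/dvdnP[m ->]|nd].
  by rewrite mulnK // [(m * d)%N]mulnC dvdn_pmul2l // divnMl.
by case: ifP => // dvd; case/negP: nd; apply: dvdn_trans dvd; apply: dvdn_mulr.
Qed.

Lemma dil_X d : dil d.+1 fX = fX ^+ d.+1.
Proof.
apply: fpsP => n; rewrite fps_coefXn /=; case: ifP => [/dvdnP[k ->]|].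
  by rewrite mulnK //= -(@eqn_pmul2r d.+1 k 1%N) // mul1n.
by case: eqP => // ->; rewrite dvdnn.
Qed.

Lemma dil_inj d : injective (dil d.+1).
Proof.
move=> f g e; apply: fpsP => n; have := congr1 (fun f : fps R => f (n * d.+1)%N) e.
by rewrite /= dvdn_mull // mulnK.
Qed.

End Dilation.

Section Map.
Variables (R S : comNzRingType) (u : {rmorphism R -> S}).
Definition fmap (f : fps R) : fps S := Fps (fun n => u (f n)).
Lemma fmapM : {morph fmap : f g / f * g}.
Proof.
move=> f g; apply: fpsP => n; rewrite /= rmorph_sum.
by apply: eq_bigr => i _; rewrite rmorphM.
Qed.
End Map.

(** Additivity of Frobenius on polynomials, and Fermat's little theorem on the
coefficients. *)
Lemma fps_frobenius p (f : fps 'F_p) : prime p -> f ^+ p = dil p f.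
Proof.
move=> p_pr; apply: fpsP => n.
have coefX k i : (i < n.+1)%N -> (f ^+ k) i = (trunc n.+1 f ^+ k)`_i.
  elim: k i => [|k IH] i lti; first by rewrite coef1.
  rewrite !exprS; apply: (fps_mul_poly lti) => j ltj; first by rewrite coef_trunc.
  exact: IH.
rewrite coefX // (dil_poly _ (prime_gt0 p_pr) (ltnSn n)).
have pcharP : p \in [pchar {poly 'F_p}] by rewrite pchar_poly pchar_Fp.
suff -> : trunc n.+1 f ^+ p = trunc n.+1 f \Po 'X^p by [].
elim/poly_ind: (trunc _ _) => [|r c IH].
  by rewrite comp_poly0 expr0n -leqn0 leqNgt prime_gt0.
rewrite -(pFrobenius_autE pcharP) pFrobenius_autD_comm; last exact: mulrC.
rewrite !pFrobenius_autE exprMn IH comp_poly_MXaddC; congr (_ + _).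
have Fermat : c ^+ p = c.
  by rewrite -(natr_Zp c) -(pFrobenius_autE (pchar_Fp p_pr)) pFrobenius_aut_nat.
by rewrite -rmorphXn /= Fermat.
Qed.

(** * Gauss's product for psi *)

Definition tri k := (k * k.+1)./2.

Arguments tri : simpl never.

Lemma tri2 k : (2 * tri k = k * k.+1)%N.
Proof. by have := odd_double_half (k * k.+1); rewrite oddM /= andbN add0n -mul2n. Qed.

Section Gauss.
Variables (A : comNzRingType) (x : A).

Definition odd_prod n := \prod_(i < n) (1 - x ^+ (2 * i + 1)).
Definition even_prod s n := \prod_(s <= i < n) (1 - x ^+ (2 * i + 2)).

Lemma odd_prodS n : odd_prod n.+1 = odd_prod n * (1 - x ^+ (2 * n + 1)).
Proof. by rewrite /odd_prod big_ord_recr. Qed.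

Lemma even_prodS s n : (s <= n)%N ->
  even_prod s n.+1 = even_prod s n * (1 - x ^+ (2 * n + 2)).
Proof. by move=> lesn; rewrite /even_prod big_nat_recr. Qed.

Lemma even_prod_recl s n : (s < n)%N ->
  even_prod s n = (1 - x ^+ (2 * s + 2)) * even_prod s.+1 n.
Proof. by move=> ltsn; rewrite /even_prod big_ltn. Qed.

Lemma even_prod_nn n : even_prod n n = 1. Proof. by rewrite /even_prod big_geq. Qed.

(** The summand at [s] is b_(s+1) - b_s, where
b_s = even_prod (s-1) n * odd_prod s * x^(s(2n+1)) and b_0 = 0: indeed
x^(2s)(1 - x^(2n+2)) - (1 - x^(2n+1)) = x^(2n+1)(1 - x^(2s+1)) - (1 - x^(2s)),
and the two factors on the right complete [odd_prod] and [even_prod]. *)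
Lemma gauss_telescope n m : (m <= n)%N ->
  \sum_(s < m.+1) (even_prod s n.+1 * odd_prod s * x ^+ (s * (2 * n + 3))
     - (1 - x ^+ (2 * n + 1)) * (even_prod s n * odd_prod s * x ^+ (s * (2 * n + 1))))
  = even_prod m n * odd_prod m.+1 * x ^+ (m.+1 * (2 * n + 1)).
Proof.
elim: m => [|m IH] lemn.
  rewrite big_ord1 /= even_prodS // odd_prodS /odd_prod big_ord0 !mul0n !mul1n muln0.
  rewrite expr0 expr1 ![(2 * n + _)%N]addnC !exprD; ring.
rewrite big_ord_recr IH ?(ltnW lemn) //= (even_prod_recl lemn).
rewrite even_prodS // [odd_prod m.+2]odd_prodS.
have -> : x ^+ (m.+1 * (2 * n + 3)) = x ^+ (m.+1 * (2 * n + 1)) * x ^+ (2 * m + 2).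
  by rewrite -exprD; congr (_ ^+ _); lia.
have -> : x ^+ (m.+2 * (2 * n + 1)) = x ^+ (m.+1 * (2 * n + 1)) * x ^+ (2 * n + 1).
  by rewrite -exprD; congr (_ ^+ _); lia.
have -> : x ^+ (2 * m.+1 + 1) = x ^+ (2 * m + 2) * x.
  by rewrite -exprSr; congr (_ ^+ _); lia.
have -> : x ^+ (2 * n + 2) = x ^+ (2 * n + 1) * x.
  by rewrite -exprSr; congr (_ ^+ _); lia.
ring.
Qed.

(** Shanks's finite form of Gauss's identity, with denominators cleared. Only the
term s = 0 on the right survives modulo x^(2n+1). *)
Lemma gauss_finite n :
  odd_prod n * \sum_(k < (2 * n).+1) x ^+ tri k
  = \sum_(s < n.+1) even_prod s n * odd_prod s * x ^+ (s * (2 * n + 1)).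
Proof.
elim: n => [|n IH]; first by rewrite muln0 !big_ord1 even_prod_nn mul0n mul1r.
have -> : ((2 * n.+1).+1 = (2 * n).+3)%N by lia.
rewrite 2!big_ord_recr /= !mulrDr {1}odd_prodS mulrAC IH.
rewrite [RHS]big_ord_recr /= even_prod_nn mul1r.
have -> : (2 * n.+1 + 1 = 2 * n + 3)%N by lia.
have -> : tri (2 * n).+2 = (n.+1 * (2 * n + 3))%N by have := tri2 (2 * n).+2; lia.
congr (_ + _); have := gauss_telescope (leqnn n).
rewrite sumrB -mulr_sumr even_prod_nn mul1r => /eqP; rewrite subr_eq => /eqP ->.
have -> : tri (2 * n).+1 = (n.+1 * (2 * n + 1))%N by have := tri2 (2 * n).+1; lia.
by rewrite addrC; congr (_ + _); rewrite mulrC.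
Qed.
End Gauss.

(** The splitting of an index range by parity serves both for products over parts
and for sums over exponents. *)
Lemma big_even_odd (T : Type) (idx : T) (op : Monoid.law idx) (F : nat -> T) M :
  \big[op/idx]_(k < (2 * M)%N) F k
  = \big[op/idx]_(j < M) op (F (2 * j)%N) (F (2 * j + 1)%N).
Proof.
elim: M => [|M IH]; first by rewrite !big_ord0.
have -> : (2 * M.+1 = (2 * M).+2)%N by lia.
by rewrite !big_ord_recr /= IH Monoid.mulmA addn1.
Qed.

Section Theta.
Variable R : comNzRingType.

Definition pow_series (e : nat -> nat) : fps R :=
  Fps (fun n => (n \in map e (iota 0 n.+1))%:R).

(** The condition k <= e k makes the first [n.+1] values of [e] decide whether
[n] is one of its values. *)
Definition growing (e : nat -> nat) := injective e /\ forall k, (k <= e k)%N.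

Lemma pow_series_sum e N M : growing e -> (N <= M)%N ->
  eqm N (pow_series e) (\sum_(k < M) fX ^+ e k).
Proof.
move=> [inj_e le_e] leNM n ltnN; rewrite fps_coef_sum /=.
under eq_bigr => k _ do rewrite fps_coefXn.
case: (@mapP _ _ e (iota 0 n.+1) n) => [[k _ def_n]|no].
  have ltkM : (k < M)%N by have := le_e k; lia.
  rewrite (bigD1 (Ordinal ltkM)) //= -def_n eqxx big1 ?addr0 // => i ne.
  rewrite def_n; case: eqP => // /inj_e eki; case/eqP: ne; exact: val_inj.
rewrite big1 // => k _; case: eqP => // def_n; case: no; exists (val k) => //.
by rewrite mem_iota /= add0n ltnS def_n le_e.
Qed.

Lemma pow_seriesP e n : growing e ->
  reflect (exists k, n = e k) (n \in map e (iota 0 n.+1)).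
Proof.
move=> [inj_e le_e]; apply: (iffP mapP) => [[k _ ->]|[k ->]]; first by exists k.
by exists k => //; rewrite mem_iota /= add0n ltnS le_e.
Qed.

Lemma growing_tri : growing tri.
Proof.
split=> [j k e|k]; last by have := tri2 k; nia.
by have := tri2 j; have := tri2 k; rewrite e; nia.
Qed.

Lemma growing_sqr : growing (fun k => k * k)%N.
Proof. by split=> [j k|k]; nia. Qed.

Definition psi := pow_series tri.
Definition sqs := pow_series (fun k => k * k)%N.
(** The sum of q^(k^2) over all integers k: each k > 0 counts twice, 0 once. *)
Definition phi := 2%:R * sqs - 1.

Lemma gauss n : eqm (2 * n + 1) (odd_prod fX n * psi) (even_prod fX 0 n).
Proof.
apply: (eqm_trans (g := odd_prod fX n * \sum_(k < (2 * n).+1) fX ^+ tri k)).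
  by apply: eqm_mul => //; apply: pow_series_sum growing_tri _; rewrite addn1.
rewrite gauss_finite big_ord_recl /= mul0n expr0 mulr1 {1}/odd_prod big_ord0 mulr1.
move=> i lti; rewrite fps_coefD fps_coef_sum big1 ?addr0 // => s _.
by rewrite mulrC (@eqm_Xn _ (2 * n + 1)) //; rewrite /bump; nia.
Qed.

Lemma dil_sum d (I : Type) (s : seq I) (F : I -> fps R) :
  dil d.+1 (\sum_(i <- s) F i) = \sum_(i <- s) dil d.+1 (F i).
Proof. exact: raddf_sum. Qed.

Lemma eqm_dil d N (f g : fps R) : eqm N f g -> eqm N (dil d f) (dil d g).
Proof.
move=> fg n ltnN /=; case: ifP => // _; apply: fg.
by rewrite (leq_ltn_trans (leq_div _ _)).
Qed.

(** (2j)^2 = 4 j^2 and (2j+1)^2 = 8 (j(j+1)/2) + 1. *)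
Lemma sqs_dissection : sqs = dil 4 sqs + fX * dil 8 psi.
Proof.
apply: eqm_all => N; apply: (eqm_trans (pow_series_sum (M := (2 * N)%N) growing_sqr _)).
  by lia.
rewrite (big_even_odd _ (fun k => fX ^+ (k * k)%N)) big_split /=.
move=> n ltnN; rewrite !fps_coefD; congr (_ + _).
  rewrite (eqm_dil 4 (pow_series_sum growing_sqr (leqnn N))) // dil_sum.
  congr (fcoef _ n); apply: eq_bigr => k _.
  by rewrite rmorphXn /= dil_X -exprM; congr (_ ^+ _); lia.
rewrite (eqm_mul (eqm_refl _) (eqm_dil 8 (pow_series_sum growing_tri (leqnn N)))) //.
rewrite dil_sum mulr_sumr; congr (fcoef _ n); apply: eq_bigr => k _.
rewrite rmorphXn /= dil_X -exprM -exprS; congr (_ ^+ _).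
by have := tri2 k; nia.
Qed.

Lemma phi_dissection : phi = dil 4 phi + 2%:R * fX * dil 8 psi.
Proof.
rewrite {1}/phi sqs_dissection /phi rmorphB rmorphM rmorph1 rmorph_nat /=; ring.
Qed.

Lemma psi0 : psi 0%N = 1. Proof. by []. Qed.
Lemma sqs0 : sqs 0%N = 1. Proof. by []. Qed.
Lemma phi0 : phi 0%N = 1.
Proof. by rewrite /phi mulr_natl fps_coefD fps_coefMn sqs0 fps_coefN /= mulr2n addrK. Qed.
End Theta.

(** * The generating function of ped *)

Section PedSeries.
Variable R : comNzRingType.

(** The signs replace q by -q; with them the series is a quotient of psi and phi
themselves rather than of psi(-q) and phi(-q). *)
Definition ped_series : fps R := Fps (fun n => (-1) ^+ n * (ped n)%:R).

Lemma fps_coefNXn k n : ((- fX : fps R) ^+ k) n = (-1) ^+ n * (n == k)%:R.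
Proof.
rewrite (exprNn fX) -(signr_odd _ k) mulr_sign.
case: ifP => odd_k; rewrite ?fps_coefN fps_coefXn; case: eqP => [->|_]; 
  by rewrite ?mulr0 ?oppr0 // -(signr_odd _ k) odd_k ?expr1 ?expr0 ?mulr1 ?mul1r.
Qed.

Definition part_term e j : fps R := if odd e || (j <= 1)%N then (- fX) ^+ (j * e) else 0.

(** Expanding the product, a choice of one multiplicity for each part size is
exactly an [m] as in the definition of [ped]; a repeated even part contributes
0, and the other choices contribute (-q)^(sum of the parts). *)
Lemma ped_series_prod n :
  ped_series n = (\prod_(i < n) \sum_(j < n.+1) part_term i.+1 j) n.
Proof.
rewrite bigA_distr_bigA fps_coef_sum /=.
rewrite /ped -sum1_card natr_sum mulr_sumr big_mkcond /=.
apply: eq_bigr => m _; rewrite inE.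
case: (boolP (even_parts_distinct m)) => [/forallP ok|/forallPn[i bad]].
  rewrite (eq_bigr (fun i : 'I_n => (- fX) ^+ (m i * i.+1))); last first.
    move=> i _; rewrite /part_term; have := ok i.
    by rewrite implybE negbK => ->.
  rewrite prodrXr.
  by rewrite fps_coefNXn andbT /is_partition eq_sym; case: eqP; rewrite ?mulr0.
rewrite andbF; move: bad; rewrite negb_imply => /andP[even_i big_i].
suff -> : \prod_(j < n) part_term j.+1 (m j) = 0 by [].
suff e0 : part_term i.+1 (m i) = 0 by rewrite (bigD1 i) //= e0 mul0r.
by rewrite /part_term (negbTE even_i) (negbTE big_i).
Qed.

(** For odd [e] this is 1 / (1 + q^e): the exponents [n] are the multiples of [e],
and then (-1)^(n/e) = (-1)^n. *)
Definition geo e : fps R := Fps (fun n => if (e %| n)%N then (-1) ^+ n else 0).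

Lemma geo_inv e : odd e -> (1 + fX ^+ e) * geo e = 1.
Proof.
move=> odd_e; have e_gt0 : (0 < e)%N by case: e odd_e.
apply: fpsP => n; rewrite mulrDl mul1r fps_coefD fps_coefXnM fps_coef1 /=.
case: leqP => [le_en|lt_ne]; last first.
  rewrite addr0; case: n lt_ne => [|n] lt_ne; first by rewrite dvdn0.
  by rewrite gtnNdvd.
rewrite (dvdn_subl le_en) ?dvdnn //; case: ifP => [_|_]; last first.
  by rewrite addr0; case: n le_en => //; lia.
rewrite -(signr_odd _ (n - e)) oddB // odd_e addbT -(signr_odd _ n).
have -> : n == 0%N = false by lia.
by case: (odd n); rewrite /= ?expr0 ?expr1 ?addNr ?subrr.
Qed.

Definition part_series e : fps R := if odd e then geo e else 1 + fX ^+ e.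

Lemma part_series_sum e n : (0 < e <= n)%N ->
  eqm n.+1 (\sum_(j < n.+1) part_term e j) (part_series e).
Proof.
move=> /andP[e_gt0 le_en]; rewrite /part_term /part_series.
case: (boolP (odd e)) => odd_e /=.
  have f0 : (1 + fX ^+ e : fps R) 0%N = 1.
    by rewrite fps_coefD fps_coefXn fps_coef1 eq_sym (gtn_eqF e_gt0) addr0.
  apply: (eqm_mulI f0); rewrite geo_inv //.
  have neg : - ((- fX) ^+ e) = fX ^+ e :> fps R.
    by rewrite exprNn -signr_odd odd_e expr1 mulN1r opprK.
  have -> : (1 + fX ^+ e) * \sum_(j < n.+1) (- fX) ^+ (j * e)
            = 1 - (- fX) ^+ (n.+1 * e) :> fps R.
    rewrite mulnC exprM -opprB subrX1 -mulNr -neg opprB; congr (_ * _).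
    by apply: eq_bigr => j _; rewrite mulnC exprM.
  move=> i lti; rewrite fps_coefD fps_coefN fps_coefNXn.
  by case: eqP => [|_]; [nia | rewrite mulr0 oppr0 addr0].
case: n le_en => [|n] le_en; first by lia.
rewrite 2!big_ord_recl big1 ?addr0; last by move=> i _.
by rewrite /= mul0n expr0 mul1n exprNn -signr_odd (negbTE odd_e) expr0 mul1r.
Qed.

Lemma part_series_eqm1 e : eqm e (part_series e) 1.
Proof.
move=> n lt_ne; rewrite /part_series fps_coef1; case: ifP => _.
  rewrite /=; case: n lt_ne => [|n] lt_ne; first by rewrite dvdn0.
  by rewrite gtnNdvd.
by rewrite fps_coefD fps_coef1 fps_coefXn (ltn_eqF lt_ne) addr0.
Qed.

Lemma ped_series_eqm M : eqm M.+1 ped_series (\prod_(i < M) part_series i.+1).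
Proof.
move=> n; rewrite ltnS ped_series_prod => le_nM.
rewrite (@eqm_prod _ n.+1 _ _ _ _ (fun i : 'I_n => part_series i.+1)) //; last first.
  by move=> i _; apply: part_series_sum; have := ltn_ord i; lia.
rewrite -(subnKC le_nM); elim: (M - n)%N => [|d IH]; first by rewrite addn0.
rewrite addnS big_ord_recr /= {}IH -[in LHS](mulr1 (\prod_(i < _) _)).
apply: (eqm_mul (eqm_refl _) _ (ltnSn n)); apply: eqm_sym.
by apply: (eqm_le _ (@part_series_eqm1 (n + d).+1)); lia.
Qed.

Definition odd_prod1 N : fps R := \prod_(i < N) (1 + fX ^+ (2 * i + 1)).
Definition even_prod1 N : fps R := \prod_(i < N) (1 + fX ^+ (2 * i + 2)).

Lemma ped_series_odd_prod N : eqm (2 * N + 1) (odd_prod1 N * ped_series) (even_prod1 N).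
Proof.
apply: (eqm_trans (eqm_mul (eqm_refl _)
                           (eqm_le _ (ped_series_eqm (M := 2 * N))))).
  by lia.
rewrite (big_even_odd _ (fun i => part_series i.+1)) /odd_prod1 /even_prod1 -big_split /=.
rewrite (eq_bigr (fun j : 'I_N => 1 + fX ^+ (2 * j + 2))) // => j _.
rewrite mulrA addn1 addn2 /part_series /= oddM /= geo_inv ?mul1r //=.
by rewrite oddM.
Qed.

Lemma coef0_prod (I : Type) (s : seq I) (F : I -> fps R) :
  (forall i, F i 0%N = 1) -> (\prod_(i <- s) F i) 0%N = 1.
Proof.
by move=> F1; elim/big_rec: _ => // i f _ f1; rewrite fps_mul_coef0 F1 f1 mulr1.
Qed.

(** Multiplying the product formulas of [psi] and [ped_series] turns each factor
1 - q^k and its partner 1 + q^k into 1 - q^(2k), which is Gauss's formula for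
psi(q^2). *)
Lemma ped_psi : psi R * ped_series = dil 2 (psi R).
Proof.
apply: eqm_all => N.
have oddE : odd_prod fX N * odd_prod1 N = dil 2 (odd_prod fX N).
  rewrite /odd_prod /odd_prod1 -big_split rmorph_prod /=; apply: eq_bigr => i _.
  by rewrite rmorphB rmorphXn rmorph1 /= dil_X exprAC; ring.
have evenE : even_prod fX 0 N * even_prod1 N = dil 2 (even_prod fX 0 N).
  rewrite /even_prod /even_prod1 big_mkord -big_split rmorph_prod /=; apply: eq_bigr => i _.
  by rewrite rmorphB rmorphXn rmorph1 /= dil_X exprAC; ring.
apply: (@eqm_le _ _ (2 * N + 1)); first by lia.
apply: (@eqm_mulI _ _ (odd_prod fX N * odd_prod1 N)).
  rewrite fps_mul_coef0 !coef0_prod ?mulr1 // => i;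
    rewrite ?fps_coefD ?fps_coefN fps_coefXn addnC /=.
    by rewrite addr0.
  by rewrite oppr0 addr0.
apply: (@eqm_trans _ _ (even_prod fX 0 N * even_prod1 N)).
  rewrite mulrACA; apply: eqm_mul; [exact: gauss | exact: ped_series_odd_prod].
rewrite evenE oddE -rmorphM /=; apply/eqm_sym/eqm_dil; exact: gauss.
Qed.
End PedSeries.

(** * Sums of two squares and the identities between phi and psi *)

Lemma size_bij (T U : eqType) (s : seq T) (t : seq U) (f : T -> U) (g : U -> T) :
  uniq s -> uniq t -> {in s, forall x, f x \in t /\ g (f x) = x} ->
  {in t, forall y, g y \in s /\ f (g y) = y} -> size s = size t.
Proof.
move=> Us Ut fP gP; have <- : size (map f s) = size s := size_map f s.
apply/perm_size/uniq_perm => // [|y].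
  by rewrite map_inj_in_uniq // => x y /fP[_ fx] /fP[_ fy] e; rewrite -fx e fy.
by apply/mapP/idP => [[x /fP[fx _] ->]|/gP[gy <-]] //; exists (g y).
Qed.

Definition int_box N : seq int := 0 :: map Posz (iota 1 N) ++ map Negz (iota 0 N).

Arguments int_box : simpl never.

Lemma mem_int_box N x : (x \in int_box N) = (absz x <= N)%N.
Proof.
rewrite /int_box inE mem_cat; case: x => k.
  rewrite (mem_map (f := Posz)) ?mem_iota; last by move=> ? ? [].
  have -> : (Posz k \in map Negz (iota 0 N)) = false by apply/negP => /mapP[].
  by rewrite orbF; case: k.
rewrite (mem_map (f := Negz)) ?mem_iota; last by move=> ? ? [].
by have -> : (Negz k \in map Posz (iota 1 N)) = false by apply/negP => /mapP[].
Qed.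

Lemma uniq_int_box N : uniq (int_box N).
Proof.
rewrite /int_box /= mem_cat cat_uniq !map_inj_uniq ?iota_uniq; try by move=> ? ? [].
rewrite andbT negb_or /= -andbA; apply/and3P; split.
- by apply/negP => /mapP[k]; rewrite mem_iota => /andP[+ _] [k0]; rewrite -k0.
- by apply/negP => /mapP[].
- by apply/hasPn => _ /mapP[k _ ->]; apply/negP => /mapP[].
Qed.

Lemma abszM_sqr (x : int) : (absz x * absz x)%N = x * x :> int.
Proof. by case: x => k; rewrite ?NegzE ?mulrNN PoszM. Qed.

Section Count.
Variable R : comNzRingType.

Definition gf (T : Type) (s : seq T) (e : T -> nat) : fps R := \sum_(x <- s) fX ^+ e x.

Lemma gf_mul (T U : Type) (s : seq T) (t : seq U) e e' n :
  (gf s e * gf t e') n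
  = (size [seq p <- [seq (x, y) | x <- s, y <- t] | e p.1 + e' p.2 == n]%N)%:R.
Proof.
rewrite size_filter -sum1_count natr_sum big_mkcond big_allpairs /gf big_distrlr /=.
rewrite fps_coef_sum; apply: eq_bigr => x _; rewrite fps_coef_sum.
by apply: eq_bigr => y _; rewrite -exprD fps_coefXn eq_sym; case: eqP.
Qed.

Lemma gf_mul_eqm (T U : Type) (s : seq T) (t : seq U) e e' n (f g : fps R) :
  eqm n.+1 f (gf s e) -> eqm n.+1 g (gf t e') ->
  (f * g) n = (size [seq p <- [seq (x, y) | x <- s, y <- t] | e p.1 + e' p.2 == n]%N)%:R.
Proof. by move=> fs gt; rewrite (eqm_mul fs gt) // gf_mul. Qed.

Lemma big_iota M (F : nat -> fps R) : \sum_(i <- iota 0 M) F i = \sum_(i < M) F i.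
Proof. by rewrite -(big_mkord xpredT) /index_iota subn0. Qed.

Lemma psi_gf N : eqm N.+1 (psi R) (gf (iota 0 N.+1) tri).
Proof.
move=> n ltn; rewrite (pow_series_sum _ growing_tri (leqnn N.+1)) // /gf.
by rewrite big_iota.
Qed.

Lemma phi_gf N : eqm N.+1 (phi R) (gf (int_box N) (fun x => absz x * absz x)%N).
Proof.
move=> n ltn; rewrite /phi mulr_natl fps_coefD fps_coefMn fps_coefN.
rewrite (pow_series_sum _ growing_sqr (leqnn N.+1)) //.
rewrite /gf /int_box big_cons big_cat !big_map /=.
rewrite big_ord_recl /=.
have -> : \sum_(i <- iota 1 N) fX ^+ (i * i)
          = \sum_(i < N) fX ^+ (bump 0 i * bump 0 i) :> fps R.
  by rewrite (iotaDl 1 0) big_map big_iota.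
have -> : \sum_(i <- iota 0 N) fX ^+ (i.+1 * i.+1)
          = \sum_(i < N) fX ^+ (bump 0 i * bump 0 i) :> fps R.
  by rewrite big_iota.
set b := fcoef _ n; ring.
Qed.
End Count.

Definition sqr_pairs n := [seq p <- [seq (x, y) | x <- int_box n, y <- int_box n] |
  absz p.1 * absz p.1 + absz p.2 * absz p.2 == n]%N.

Lemma mem_sqr_pairs n (p : int * int) :
  (p \in sqr_pairs n) = (p.1 * p.1 + p.2 * p.2 == n%:Z).
Proof.
rewrite mem_filter -!abszM_sqr -PoszD eqz_nat; case: eqP => // e; rewrite andTb.
case: p e => x y e; rewrite /= in e; apply: allpairs_f; rewrite mem_int_box; nia.
Qed.

Lemma uniq_sqr_pairs n : uniq (sqr_pairs n).
Proof.
by apply/filter_uniq/allpairs_uniq; rewrite ?uniq_int_box // => -[? ?] [? ?] _ _ /=.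
Qed.

(** The map (x, y) -> (x + y, x - y) doubles x^2 + y^2, and it reaches every pair
of integers of the same parity. *)
Lemma size_sqr_pairs_double n : size (sqr_pairs (2 * n)) = size (sqr_pairs n).
Proof.
apply: (size_bij (f := fun p => (((p.1 + p.2) %/ 2)%Z, ((p.1 - p.2) %/ 2)%Z))
                 (g := fun p => (p.1 + p.2, p.1 - p.2)));
  rewrite ?uniq_sqr_pairs // => -[x y]; rewrite mem_sqr_pairs /= => /eqP e.
  have [u [v [ex ey]]] : exists u v, x = u + v /\ y = u - v.
    have [a ea] : exists a, x = 2 * a \/ x = 2 * a + 1 by exists (x %/ 2)%Z; lia.
    have [b eb] : exists b, y = 2 * b \/ y = 2 * b + 1 by exists (y %/ 2)%Z; lia.
    case: ea eb => ea [] eb; rewrite {}ea {}eb in e *; [| exfalso; lia | exfalso; lia |].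
      by exists (a + b), (a - b); lia.
    by exists (a + b + 1), (a - b); lia.
  rewrite {}ex {}ey in e *; rewrite mem_sqr_pairs /=; split; last by congr (_, _); lia.
  have -> : ((u + v + (u - v)) %/ 2)%Z = u by lia.
  have -> : ((u + v - (u - v)) %/ 2)%Z = v by lia.
  by apply/eqP; nia.
rewrite mem_sqr_pairs /=; split; last by congr (_, _); lia.
by apply/eqP; nia.
Qed.

Section ThetaIdentities.
Variable R : idomainType.
Hypothesis four_neq0 : 4%:R != 0 :> R.
Local Notation phi := (phi R).
Local Notation psi := (psi R).

Lemma phi_sqr_double n : (phi ^+ 2) (2 * n)%N = (phi ^+ 2) n.
Proof.
have E m : (phi ^+ 2) m = (size (sqr_pairs m))%:R.
  by rewrite expr2; exact: (gf_mul_eqm (@phi_gf R m) (@phi_gf R m)).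
by rewrite !E size_sqr_pairs_double.
Qed.

(** The square of a series that splits by parity of exponents, itself sorted by
parity: the first term is even, the cross term is odd. *)
Lemma dissection_sqr (p s : fps R) : p = dil 4 p + 2%:R * fX * dil 8 s ->
  p ^+ 2 = dil 2 (dil 2 p ^+ 2 + 4%:R * fX * dil 4 s ^+ 2)
           + fX * (dil 4 (p * dil 2 s) *+ 4).
Proof.
move=> def_p; rewrite !(rmorphXn, rmorphM, rmorphD, rmorph_nat) /= dil_X !dil_dil //.
rewrite -[(2 * 2)%N]/4%N -[(2 * 4)%N]/8%N -[(4 * 2)%N]/8%N.
rewrite [in LHS]def_p; ring.
Qed.

(** The even part of phi^2 is phi(q^2)^2 since r_2(2n) = r_2(n); by the dissection
of phi it is also the right-hand side with q^2 for q. *)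
Lemma phi_sqr_even : phi ^+ 2 = dil 2 phi ^+ 2 + 4%:R * fX * dil 4 psi ^+ 2.
Proof.
apply: fpsP => n; rewrite -phi_sqr_double (dissection_sqr (phi_dissection R)).
set U := _ + 4%:R * _ * _; set V := phi * _.
rewrite fps_coefD [X in _ + X](_ : _ = 0) ?addr0.
  by rewrite /= dvdn_mulr // mulKn.
rewrite -[fX]expr1 fps_coefXnM; case: ifP => // n_gt0; rewrite fps_coefMn /=.
have -> : (4 %| 2 * n - 1)%N = false by lia.
by rewrite mul0rn.
Qed.

(** Two expressions for the odd part of phi^2, one from [phi_sqr_even] and one
from squaring the dissection, must agree. *)
Lemma psi_sqr : psi ^+ 2 = dil 2 psi * phi.
Proof.
have e : phi ^+ 2 = dil 2 (phi ^+ 2) + fX * (dil 4 (psi ^+ 2) *+ 4).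
  by rewrite [LHS]phi_sqr_even !rmorphXn /=; ring.
have := dissection_sqr (phi_dissection R).
rewrite -phi_sqr_even [LHS]e => /addrI.
move/fXI => e4; rewrite mulrC; apply: (@dil_inj _ 3); apply: fpsP => n.
have := congr1 (fun f : fps R => f n) e4; rewrite !fps_coefMn => /eqP.
rewrite -subr_eq0 -mulrnBl -mulr_natr mulf_eq0 (negbTE four_neq0) orbF.
by rewrite subr_eq0 => /eqP.
Qed.

Lemma ped_phi : ped_series R * phi = psi.
Proof.
apply: (coef0_mulI (psi0 R)); rewrite mulrA ped_psi -psi_sqr; ring.
Qed.

(** Squaring [phi_sqr_even] and using [psi_sqr] shows that
E = phi^4 + 16 q psi(q^2)^4 satisfies E(q) = E(q^2) + 24 q psi(q^2)^4. In
characteristic 3 it is therefore invariant under q -> q^2, hence constant. *)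
Lemma phi_pow4_char3 : 3%:R = 0 :> R ->
  phi ^+ 4 = 1 - fX * dil 2 psi ^+ 4.
Proof.
move=> three0; have three n (f : fps R) : f *+ (3 * n) = 0.
  by apply: fpsP => m; rewrite fps_coefMn -mulr_natr natrM three0 mul0r mulr0.
pose E := phi ^+ 4 + 16%:R * fX * dil 2 psi ^+ 4.
have EE : E = dil 2 E.
  have e4 : dil 2 phi ^+ 2 * dil 4 psi ^+ 2 = dil 2 psi ^+ 4.
    have e2 : dil 2 psi ^+ 2 = dil 4 psi * dil 2 phi.
      by rewrite -rmorphXn psi_sqr rmorphM /= dil_dil.
    by rewrite -[dil 2 psi ^+ 4]/(dil 2 psi ^+ (2 * 2)) exprM e2; ring.
  have dilE p s : dil 2 (p ^+ 4 + 16%:R * fX * dil 2 s ^+ 4)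
      = dil 2 p ^+ 4 + 16%:R * fX ^+ 2 * dil 4 s ^+ 4 :> fps R.
    by rewrite !(rmorphXn, rmorphM, rmorphD, rmorph_nat) /= dil_X dil_dil.
  have := three 8%N (fX * dil 2 psi ^+ 4); rewrite /E dilE => e0.
  rewrite -[phi ^+ 4]/(phi ^+ (2 * 2)) exprM phi_sqr_even -[RHS]addr0 -e0.
  ring: e4.
have E1 : E = 1.
  apply: fpsP; elim/ltn_ind => -[|n] IH.
    rewrite /E fps_coefD -mulrA mulrCA -[fX]expr1 fps_coefXnM addr0.
    by rewrite !exprS expr0 !fps_mul_coef0 phi0 !mul1r.
  rewrite EE coef_dil; case: ifP => // dvd; rewrite IH ?ltn_Pdiv // fps_coef1.
  by have -> : (n.+1 %/ 2 == 0)%N = false by lia.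
have := three 5%N (fX * dil 2 psi ^+ 4); rewrite -E1 /E => e0.
by rewrite -[LHS]addr0 -e0; ring.
Qed.
End ThetaIdentities.

(** * Exponents modulo 9 *)

Section Support.
Variable R : comNzRingType.
Implicit Types f g : fps R.

Definition supp9 f (A : seq nat) := forall n, (n %% 9)%N \notin A -> f n = 0.

Lemma supp9_mul f g A B : supp9 f A -> supp9 g B ->
  supp9 (f * g) [seq (a + b) %% 9 | a <- A, b <- B]%N.
Proof.
move=> fA gB n nAB; rewrite fps_coefM big1 // => i _.
case: (boolP (i %% 9 \in A)%N) => [iA|/fA->]; last by rewrite mul0r.
case: (boolP ((n - i) %% 9 \in B)%N) => [jB|/gB->]; last by rewrite mulr0.
case/negP: nAB; apply/allpairsP; exists (i %% 9, (n - i) %% 9)%N; split=> //=.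
by rewrite modnDm subnKC // -ltnS.
Qed.

Lemma supp9_pow_series e A :
  growing e -> (forall k, (e k %% 9)%N \in A) -> supp9 (pow_series R e) A.
Proof. by move=> ge eA n nA /=; case: (pow_seriesP n ge) nA => // -[k ->]; rewrite eA. Qed.

Lemma supp9_dil d f A : (0 < d)%N -> supp9 f A ->
  supp9 (dil d f) [seq (d * a) %% 9 | a <- A]%N.
Proof.
move=> d_gt0 fA n nA /=; case: ifP => // /dvdnP[k def_n].
rewrite def_n mulnK // fA //; apply: contra nA => kA; apply/mapP; exists (k %% 9)%N => //.
by rewrite modnMmr def_n mulnC.
Qed.

Lemma supp9_fX : supp9 fX [:: 1%N].
Proof. by move=> n; rewrite inE /=; case: (n =P 1%N) => [->|]. Qed.

Lemma tri_mod9 k : (tri k %% 9)%N \in [:: 0; 1; 3; 6]%N.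
Proof.
have := tri2 k; rewrite {2 3}(divn_eq k 9); have := ltn_pmod k (isT : 0 < 9)%N.
move: (k %/ 9)%N (k %% 9)%N (tri k) => m r t; rewrite !inE.
by do 9?[case: r => [|r]; first by lia]; lia.
Qed.

Lemma sqr_mod9 k : (k * k %% 9)%N \in [:: 0; 1; 4; 7]%N.
Proof.
rewrite (divn_eq k 9); have := ltn_pmod k (isT : 0 < 9)%N.
move: (k %/ 9)%N (k %% 9)%N => m r; rewrite !inE.
by do 9?[case: r => [|r]; first by lia]; lia.
Qed.

Lemma supp9_psi : supp9 (psi R) [:: 0; 1; 3; 6]%N.
Proof. exact: (supp9_pow_series growing_tri tri_mod9). Qed.

Lemma supp9_sqs : supp9 (sqs R) [:: 0; 1; 4; 7]%N.
Proof. exact: (supp9_pow_series growing_sqr sqr_mod9). Qed.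

Lemma supp9_phi : supp9 (phi R) [:: 0; 1; 4; 7]%N.
Proof.
move=> n nA; rewrite /phi mulr_natl fps_coefD fps_coefMn supp9_sqs // mul0rn add0r.
by rewrite fps_coefN fps_coef1; case: eqP nA => [->|]; rewrite ?oppr0.
Qed.

Lemma supp9_dil9 f : supp9 (dil 9 f) [:: 0%N].
Proof. by move=> n; rewrite inE /= /dvdn => /negbTE->. Qed.

Definition vanish r f := forall n, (n %% 9 = r)%N -> f n = 0.

Lemma supp9_vanish r f A : supp9 f A -> r \notin A -> vanish r f.
Proof. by move=> fA rA n def_r; rewrite fA ?def_r. Qed.

(** Multiplication by a series in q^9 preserves classes of exponents modulo 9, and
so does its inverse. *)
Lemma vanish_cancel r f g : g 0%N = 1 -> vanish r (f * dil 9 g) -> vanish r f.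
Proof.
move=> g0 van n; elim/ltn_ind: n => n IH def_r.
have := van n def_r; rewrite mulrC fps_coefM big_ord_recl /= g0 mul1r subn0.
rewrite big1 ?addr0 // => i _; case: ifP => [dvd|]; last by rewrite mul0r.
by rewrite IH ?mulr0 //; rewrite /bump in dvd *; have := ltn_ord i; lia.
Qed.
End Support.

(** * The coefficients in the class of 7 modulo 9 *)

Lemma ped_mod3 n : (n %% 9 = 7)%N -> ped_series 'F_3 n = 0.
Proof.
have four : 4%:R != 0 :> 'F_3 by [].
have three : 3%:R = 0 :> 'F_3 by apply/eqP.
have e1 := ped_phi four; have e2 := psi_sqr four; have e3 := phi_pow4_char3 four three.
have pow3 (f : fps 'F_3) : f ^+ 3 = dil 3 f by exact: fps_frobenius.
have pow9 (f : fps 'F_3) : f ^+ 9 = dil 9 f.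
  by rewrite -[9%N]/(3 * 3)%N exprM !pow3 dil_dil.
move: n; set P := ped_series 'F_3 in e1 *.
set F := phi 'F_3 in e1 e2 e3; set S := psi 'F_3 in e1 e2 e3.
set S2 := dil 2 S in e2 e3.
have e5 : F ^+ 5 = F - fX * S2 ^+ 3 * S ^+ 2 by rewrite exprS e3 e2; ring.
(* Multiplying [e3] by phi^4, the term q psi(q^2)^4 phi^4 is q psi^8 by [psi_sqr]. *)
have e8 : F ^+ 8 = 1 - fX * S2 ^+ 4 - fX * S ^+ 8.
  rewrite -[8%N in LHS]/(4 + 4)%N exprD {1}e3 -[S ^+ 8]/(S ^+ (2 * 4)) exprM e2.
  by rewrite mulrBl mul1r {1}e3; ring.
(* With phi^18 as the multiplier, P phi^18 = psi phi^9 phi^8, and [e8] leaves only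
   ninth powers times series whose exponents are known modulo 9. *)
have main : P * dil 9 (F ^+ 2) = dil 9 F * S - fX * dil 9 S * F
    + fX * fX * dil 9 S * dil 6 S * (S * S) - fX * dil 9 S * dil 9 F.
  rewrite -[dil 6 S](dil_dil 2 S (isT : 0 < 3)%N) -/S2 -pow3 -!pow9.
  have -> : P * (F ^+ 2) ^+ 9 = S * F ^+ 9 * F ^+ 8 by rewrite -e1; ring.
  rewrite e8; have -> : S * F ^+ 9 * (1 - fX * S2 ^+ 4 - fX * S ^+ 8)
     = S * F ^+ 9 - fX * S * (S2 * F) ^+ 4 * F ^+ 5 - fX * S ^+ 9 * F ^+ 9 by ring.
  by rewrite -e2 e5; ring.
apply: (@vanish_cancel _ 7 P (F ^+ 2)).
  by rewrite expr2 fps_mul_coef0 phi0 mulr1.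
move=> n def_n; rewrite main !fps_coefD !fps_coefN.
have d9 f := @supp9_dil9 'F_3 f; have sX := @supp9_fX 'F_3.
have sS := @supp9_psi 'F_3; have sF := @supp9_phi 'F_3.
rewrite (supp9_vanish (supp9_mul (d9 F) sS) _ def_n) //.
rewrite (supp9_vanish (supp9_mul (supp9_mul sX (d9 S)) sF) _ def_n) //.
rewrite (supp9_vanish (supp9_mul (supp9_mul sX (d9 S)) (d9 F)) _ def_n) //.
rewrite (supp9_vanish (supp9_mul (supp9_mul (supp9_mul (supp9_mul sX sX) (d9 S))
  (@supp9_dil _ 6 _ _ isT sS)) (supp9_mul sS sS)) _ def_n) //.
by rewrite oppr0 !addr0.
Qed.

(** Modulo 2 the square of [sqs] is sqs(q^2), and twice a square plus a triangular
number is never 7 modulo 9. *)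
Lemma sqs_psi_mod2 n : (n %% 9 = 7)%N -> (2 %| (sqs int ^+ 2 * psi int) n)%Z.
Proof.
move=> def_n; rewrite (dvdz_pcharf (pchar_Fp (isT : prime 2))).
pose u : {rmorphism int -> 'F_2} := intr.
have map_pow_series e : fmap u (pow_series int e) = pow_series 'F_2 e.
  by apply: fpsP => m; rewrite /= rmorph_nat.
rewrite -[_%:~R]/(fmap u (sqs int ^+ 2 * psi int) n) expr2 !fmapM !map_pow_series -expr2.
rewrite fps_frobenius //; apply/eqP.
have sQ := @supp9_dil _ 2 _ _ isT (@supp9_sqs 'F_2).
by rewrite (supp9_vanish (supp9_mul sQ (@supp9_psi 'F_2)) _ def_n).
Qed.

Lemma ped_mod8 n : (n %% 9 = 7)%N ->
  exists y : int, ped_series int n = - (psi int * phi int) n + y *+ 8.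
Proof.
move=> def_n; have e := ped_phi (isT : 4%:R != 0 :> int).
set P := ped_series int in e *; set S := psi int in e *; pose Q := sqs int.
have defP : P = 2%:R * Q * P - S by rewrite -e /phi -/Q; ring.
(* Three steps of the iteration of [defP]. *)
have main : P = - (S * phi int) - S *+ 2 - (Q ^+ 2 * S) *+ 4 + (Q ^+ 3 * P) *+ 8.
  by rewrite /phi -/Q {1}defP {1}defP {1}defP; ring.
have /dvdzP[z def_z] := sqs_psi_mod2 def_n.
exists ((Q ^+ 3 * P) n - z); rewrite {1}main !fps_coefD !fps_coefN !fps_coefMn def_z.
by rewrite (supp9_vanish (@supp9_psi int) _ def_n) //; ring.
Qed.

(** * Representations of 8N + 1 by x^2 + 8 y^2 *)

(** The pairs (k, y) stand for the solutions of x^2 + 8 y^2 = 8N + 1 with x > 0,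
through x = 2k + 1. *)
Definition reps N := [seq p <- [seq (k, y) | k <- iota 0 N.+1, y <- int_box N] |
  tri p.1 + absz p.2 * absz p.2 == N]%N.

Lemma mem_reps N (p : nat * int) :
  (p \in reps N) = ((2 * p.1%:Z + 1) ^+ 2 + 8 * p.2 ^+ 2 == 8 * N%:Z + 1).
Proof.
case: p => k y; rewrite mem_filter.
have eqN : (tri k + absz y * absz y == N)%N
           = ((2 * k%:Z + 1) ^+ 2 + 8 * y ^+ 2 == 8 * N%:Z + 1).
  have T2 := tri2 k; have Y2 := abszM_sqr y.
  by move: (absz y * absz y)%N Y2 => w Y2; apply/eqP/eqP; lia.
rewrite -eqN; case: eqP => // e; rewrite andTb; rewrite /= in e; apply: allpairs_f.
  by rewrite mem_iota; have := growing_tri.2 k; lia.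
by rewrite mem_int_box; nia.
Qed.

Lemma uniq_reps N : uniq (reps N).
Proof.
apply/filter_uniq/allpairs_uniq; rewrite ?uniq_int_box ?iota_uniq //.
by move=> -[? ?] [? ?] _ _ /=.
Qed.

Lemma psi_phi_reps N : (psi int * phi int) N = (size (reps N))%:R.
Proof. exact: (gf_mul_eqm (@psi_gf int N) (@phi_gf int N)). Qed.

(** Because -8, that is 2, is not a square modulo 5. *)
Lemma five_dvd (x y : int) : (5 %| x ^+ 2 + 8 * y ^+ 2)%Z ->
  exists u v, x = 5 * u /\ y = 5 * v.
Proof.
have red (z : int) : exists w r, z = 5 * w + r /\ 0 <= r < 5.
  by exists (z %/ 5)%Z, (z %% 5)%Z; lia.
have [u [r [ex r5]]] := red x; have [v [s [ey s5]]] := red y.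
case/dvdzP => q e; exists u, v; subst x y.
have : r = 0 \/ r = 1 \/ r = 2 \/ r = 3 \/ r = 4 by lia.
have : s = 0 \/ s = 1 \/ s = 2 \/ s = 3 \/ s = 4 by lia.
by move=> [?|[?|[?|[?|?]]]] [?|[?|[?|[?|?]]]]; subst; lia.
Qed.

Lemma reps_empty N : (5 %| 8 * N + 1)%N -> ~~ (25 %| 8 * N + 1)%N -> size (reps N) = 0%N.
Proof.
move=> d5 nd25; case: (reps N) (mem_reps N) => // -[k y] s /(_ (k, y)).
rewrite mem_head => /esym/eqP /= e; case/negP: nd25.
have [|u [v [ex ey]]] := @five_dvd (2 * k%:Z + 1) y; first by rewrite e; lia.
rewrite ex ey in e; lia.
Qed.

Lemma reps_scale M N : (8 * M + 1 = 25 * (8 * N + 1))%N -> size (reps M) = size (reps N).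
Proof.
move=> eMN.
apply: (size_bij (f := fun p => ((p.1 %/ 5)%N, (p.2 %/ 5)%Z))
                 (g := fun p => ((5 * p.1 + 2)%N, 5 * p.2)));
  rewrite ?uniq_reps // => -[k y]; rewrite mem_reps /= => /eqP e.
  have [|u [v [ex ey]]] := @five_dvd (2 * k%:Z + 1) y; first by rewrite e; lia.
  have [j ek] : exists j : nat, k = (5 * j + 2)%N by exists (k %/ 5)%N; lia.
  have eu : u = 2 * j%:Z + 1 by lia.
  rewrite ex ey eu in e; rewrite {}ek {}ey mem_reps /=; split.
    have -> : ((5 * j + 2) %/ 5)%N = j by lia.
    have -> : ((5 * v) %/ 5)%Z = v by lia.
    by apply/eqP; lia.
  by congr (_, _); lia.
rewrite mem_reps /=; split; first by apply/eqP; lia.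
by congr (_, _); lia.
Qed.

(** In Z[sqrt(-2)], x + 2y sqrt(-2) is multiplied by (1 - sqrt(-2)) / (1 + sqrt(-2)),
a number of norm 1, followed by conjugation and a choice of signs: the pair
becomes ((8y - x)/3, (x + y)/3), integral when 3 divides x + y. With
v = (x + y)/3, the first entry is u = 8v - 3x; the sign is chosen so that
it becomes positive. *)
Definition rot3 (p : nat * int) : nat * int :=
  let v := ((2 * p.1%:Z + 1 + p.2) %/ 3)%Z in
  let u := 8 * v - 3 * (2 * p.1%:Z + 1) in
  ((absz u)./2, if 0 < u then v else - v).

Lemma rot3P k y : (3 %| 2 * k%:Z + 1 + y)%Z ->
  exists k' y' v, [/\ rot3 (k, y) = (k', y'), 2 * k%:Z + 1 + y = 3 * v &
    (2 * k'%:Z + 1 = 8 * v - 3 * (2 * k%:Z + 1) /\ y' = v) \/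
    (2 * k'%:Z + 1 = - (8 * v - 3 * (2 * k%:Z + 1)) /\ y' = - v)].
Proof.
case/dvdzP => v ev; rewrite /rot3 /=.
have -> : ((2 * k%:Z + 1 + y) %/ 3)%Z = v by lia.
set u := _ - _; exists (absz u)./2, (if 0 < u then v else - v), v.
split=> //; first by lia.
by case: ifP => u_gt0; [left | right]; split=> //; rewrite /u in u_gt0 *; lia.
Qed.

(** Two factors of 2. As 8N + 1 = 3 modulo 9, exactly one of x + y and x - y is
divisible by 3, so y -> -y exchanges two halves of the solutions. On the half
where 3 divides x + y, [rot3] is an involution without fixed point: a fixed
point would have x = 2y or x = -4y, whereas x is odd. *)
Lemma reps_dvd4 N : (N %% 9 = 7)%N -> (4 %| size (reps N))%N.
Proof.
move=> N7; pose A (p : nat * int) := (3 %| 2 * p.1%:Z + 1 + p.2)%Z.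
have eqA (p : nat * int) : p \in reps N ->
  (2 * p.1%:Z + 1) ^+ 2 + 8 * p.2 ^+ 2 = 8 * N%:Z + 1.
  by rewrite mem_reps => /eqP.
have oppA (p : nat * int) : p \in reps N -> A (p.1, - p.2) = ~~ A p.
  move/eqA; rewrite /A /=; move: (2 * p.1%:Z + 1) p.2 => x y e.
  have red (z : int) : exists w r, z = 3 * w + r /\ 0 <= r < 3.
    by exists (z %/ 3)%Z, (z %% 3)%Z; lia.
  have [u [r [ex r3]]] := red x; have [v [s [ey s3]]] := red y; subst x y.
  have : r = 0 \/ r = 1 \/ r = 2 by lia.
  have : s = 0 \/ s = 1 \/ s = 2 by lia.
  by move=> [?|[?|?]] [?|[?|?]]; subst; lia.
have opp_reps (p : nat * int) : p \in reps N -> (p.1, - p.2) \in reps N.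
  by rewrite !mem_reps sqrrN.
have half1 : size (filter A (reps N)) = size (filter (predC A) (reps N)).
  apply: (size_bij (f := fun p => (p.1, - p.2)) (g := fun p => (p.1, - p.2)));
    rewrite ?(filter_uniq _ (uniq_reps N)) // => -[k y];
    rewrite !(mem_filter _ _ (reps N)) => /andP[Ap ps];
    have /= -> := opp_reps _ ps; have /= -> := oppA _ ps;
    by move: Ap => /= ->; rewrite opprK.
pose s := filter A (reps N).
(* [B] selects one element of each orbit of [rot3]. *)
pose B (p : nat * int) := ((rot3 p).1 < p.1)%N.
have rot_s (p : nat * int) : p \in s ->
  [/\ rot3 p \in s, rot3 (rot3 p) = p & B (rot3 p) = ~~ B p].
  case: p => k y; rewrite (mem_filter _ _ (reps N)) => /andP[Ap /eqA /= e].
  have [k' [y' [v [er ev rel]]]] := rot3P Ap; rewrite /= in ev rel; rewrite /B er.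
  have A' : A (k', y').
    by apply/dvdzP; case: rel => -[ex ey]; [exists y | exists (- y)]; rewrite /=; lia.
  have [k2 [y2 [v' [er' ev' rel']]]] := rot3P A'; rewrite /= in ev' rel'; rewrite er' /=.
  have [ek ey] : k2 = k /\ y2 = y by lia.
  rewrite ek ey; split=> //; last by lia.
  rewrite (mem_filter _ _ (reps N)) A' mem_reps /=; apply/eqP.
  have y_def : y = 3 * v - (2 * k%:Z + 1) by lia.
  by case: rel => -[-> ->]; rewrite -e y_def; ring.
have half2 : size (filter B s) = size (filter (predC B) s).
  have Us : uniq s by apply/filter_uniq/uniq_reps.
  by apply: (size_bij (f := rot3) (g := rot3));
    rewrite ?(filter_uniq _ Us) // => p; rewrite !(mem_filter _ _ s);
    case/andP => [Bp /rot_s[ps rr Br]]; rewrite ps /= Br; move: Bp => /= ->.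
have := count_predC A (reps N); have := count_predC B s.
rewrite -!size_filter -half1 -half2 -/s => e2 e1; lia.
Qed.

(** The sign (-1)^N of [ped_series] drops out modulo 8 because 4 divides the number
of solutions. *)
Lemma ped_reps N : (N %% 9 = 7)%N ->
  (3 %| ped N)%N /\ ped N = size (reps N) %[mod 8].
Proof.
move=> N7; split.
  have := ped_mod3 N7; rewrite /= => /eqP.
  rewrite -signr_odd mulr_sign; case: ifP => _;
    by rewrite ?oppr_eq0 -(dvdn_pcharf (pchar_Fp (isT : prime 3))).
have [y] := ped_mod8 N7; have /dvdnP[c ec] := reps_dvd4 N7.
rewrite psi_phi_reps ec /= -signr_odd mulr_sign; case: ifP => _ e; lia.
Qed.

Lemma eq_mod24 a b : (3 %| a)%N -> (3 %| b)%N -> a = b %[mod 8] -> a = b %[mod 24].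
Proof. by lia. Qed.

Lemma ped_eq0_mod24 N : (N %% 9 = 7)%N -> (5 %| 8 * N + 1)%N -> ~~ (25 %| 8 * N + 1)%N ->
  ped N = 0 %[mod 24].
Proof.
by move=> N7 d5 nd25; have [d3 e] := ped_reps N7; apply: eq_mod24; rewrite // e reps_empty.
Qed.

Lemma pow25_mod24 k : exists j, (25 ^ k = 24 * j + 1)%N.
Proof.
elim: k => [|k [j ej]]; first by exists 0%N.
by exists (25 * j + 1)%N; rewrite expnS ej; lia.
Qed.

(** The intermediate arguments L with 8L + 1 = 25^k (8N + 1) are integers since
25^k is 1 modulo 8. *)
Lemma reps_scale_pow k N M : (8 * M + 1 = 25 ^ k * (8 * N + 1))%N ->
  size (reps M) = size (reps N).
Proof.
elim: k M => [|k IH] M e; first by congr (size (reps _)); lia.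
have [j ej] := pow25_mod24 k.
pose L := (25 ^ k * N + 3 * j)%N.
have eL : (8 * L + 1 = 25 ^ k * (8 * N + 1))%N by rewrite /L; lia.
by rewrite -(IH L eL); apply: reps_scale; rewrite e expnS eL mulnA.
Qed.

Local Close Scope ring_scope.

Theorem theorem1p1 :
  (forall n : nat,
     [/\ ped (225 * n + 43) = 0 %[mod 24],
         ped (225 * n + 88) = 0 %[mod 24],
         ped (225 * n + 133) = 0 %[mod 24]
       & ped (225 * n + 223) = 0 %[mod 24]]) /\
  (forall k n : nat, 1 <= k ->
     ped (9 * n + 7) =
     ped (9 * 5 ^ (2 * k) * n + (57 * 5 ^ (2 * k) - 1) %/ 8) %[mod 24]).
Proof.
split=> [n|k n _]; first by split; apply: ped_eq0_mod24; lia.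
rewrite expnM -[5 ^ 2]/25.
have [j ej] := pow25_mod24 k.
set M := (X in ped X = _ %[mod 24]); set N := _ + _ %/ 8.
have eM : N = 9 * (25 ^ k * n + 19 * j) + 7 by rewrite /N ej; lia.
have [d3 e3] : 3 %| ped M /\ ped M = size (reps M) %[mod 8].
  by apply: ped_reps; rewrite /M; lia.
have [d3' e3'] : 3 %| ped N /\ ped N = size (reps N) %[mod 8].
  by apply: ped_reps; rewrite eM; lia.
apply: eq_mod24 => //; rewrite e3 e3' (@reps_scale_pow k M N) //.
by rewrite eM /M; nia.
Qed.
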